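(* Let $\mathbb{F}$ be a field with involution $\overline{\,\cdot\,}$, let $m,n\ge 1$, let $x,y\in\mathbb{F}^m$ and $z,w\in\mathbb{F}^n$ be column vectors with all entries nonzero, let $a,b\in\mathbb{F}\setminus\{0\}$, and let $$M=\left[\begin{array}{cc|cc}0&x^T&a&0\\ y&0&0&0\\ \hline b&0&0&z^T\\ 0&0&w&0\end{array}\right]$$ (a square matrix of order $m+n+2$). Assume $x^Ty\neq 0$, $z^Tw=0$ and $\zeta:=x^Ty+ab\neq 0$. Then: (1) $M$ is core EP invertible if and only if $h:=b\overline{b}+y^*y\neq 0$ and $\beta:=\zeta\overline{\zeta}+b\overline{b}\,w^*w\neq 0$. In this case, $$M^{\mathrm{cEP}}=\left[\begin{array}{cc|cc}0&h^{-1}y^*&h^{-1}\overline{b}&0\\ \beta^{-1}\overline{\zeta}y&0&0&\beta^{-1}\overline{b}yw^*\\ \hline \beta^{-1}\overline{\zeta}b&0&0&\beta^{-1}b\overline{b}w^*\\ 0&bh^{-1}\zeta^{-1}wy^*&b\overline{b}h^{-1}\zeta^{-1}w&0\end{array}\right].$$ (2) $M$ is dual core EP invertible if and only if $q:=a\overline{a}+x^*x\neq 0$ and $\alpha:=\zeta\overline{\zeta}+a\overline{a}\,z^*z\neq 0$. In this case, $$M_{\mathrm{cEP}}=\left[\begin{array}{cc|cc}0&\overline{\zeta}\alpha^{-1}x^T&\overline{\zeta}\alpha^{-1}a&0\\ q^{-1}\overline{x}&0&0&(q\zeta)^{-1}a\overline{x}z^T\\ \hline \overline{a}q^{-1}&0&0&(q\zeta)^{-1}a\overline{a}z^T\\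 0&\overline{a}\alpha^{-1}\overline{z}x^T&a\overline{a}\alpha^{-1}\overline{z}&0\end{array}\right].$$
   Context: For a matrix $A=[a_{ij}]$ over a field $\mathbb{F}$ with involution $\overline{\,\cdot\,}$ (a field automorphism with $\overline{\overline{c}}=c$), $\overline{A}=[\overline{a_{ij}}]$ and $A^*=\overline{A}^{\,T}$. All $4\times4$ block matrices have rows and columns partitioned with sizes $1,m,1,n$; each $0$ is a zero block of the appropriate size. Matrices $M$ of the displayed form (with $a,b$ and all entries of $x,y,z,w$ nonzero) are the matrices whose associated digraph is a double star digraph, in canonical form. A square matrix $A$ is core EP invertible if there is a matrix $X$ with $XA^{k+1}=A^k$ for some nonnegative integer $k$, $AX^2=X$, and $(AX)^*=AX$; such $X$ is unique and is called the core EP inverse, denoted $A^{\mathrm{cEP}}$. Dually, $A$ is dual core EP invertible if there is a matrix $X$ with $A^{k+1}X=A^k$ for some nonnegative integer $k$, $X^2A=X$, and $(XA)^*=XA$; such $X$ is unique and is called the dual core EP inverse, denoted $A_{\mathrm{cEP}}$. *)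

(* Defs.v *)
From HB Require Import structures.
From mathcomp Require Import all_boot all_order all_algebra.

Set Implicit Arguments.
Unset Strict Implicit.
Unset Printing Implicit Defensive.

Import GRing.Theory.
Local Open Scope ring_scope.

(* An involution on F is a ring endomorphism conj with [involutive conj];
   it is then automatically a field automorphism, possibly the identity. *)
Definition adjmx (F : fieldType) (conj : {rmorphism F -> F}) (p q : nat)
    (A : 'M[F]_(p, q)) : 'M[F]_(q, p) :=
  (map_mx conj A)^T.

Definition is_core_EP_inverse (F : fieldType) (conj : {rmorphism F -> F})
    (p : nat) (A X : 'M[F]_p) : Prop :=
  [/\ exists k : nat, X *m A ^+ k.+1 = A ^+ k,
      A *m X ^+ 2 = X
    & adjmx conj (A *m X) = A *m X].

Definition core_EP_invertible (F : fieldType) (conj : {rmorphism F -> F})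
    (p : nat) (A : 'M[F]_p) : Prop :=
  exists X : 'M[F]_p, is_core_EP_inverse conj A X.

Definition is_dual_core_EP_inverse (F : fieldType) (conj : {rmorphism F -> F})
    (p : nat) (A X : 'M[F]_p) : Prop :=
  [/\ exists k : nat, A ^+ k.+1 *m X = A ^+ k,
      X ^+ 2 *m A = X
    & adjmx conj (X *m A) = X *m A].

Definition dual_core_EP_invertible (F : fieldType) (conj : {rmorphism F -> F})
    (p : nat) (A : 'M[F]_p) : Prop :=
  exists X : 'M[F]_p, is_dual_core_EP_inverse conj A X.

(* The scalar x^T y; no conjugation is involved, so that x^* y is
   [dotcv (map_mx conj x) y]. *)
Definition dotcv (F : fieldType) (p : nat) (x y : 'cV[F]_p) : F :=
  (x^T *m y) 0 0.

Definition double_star_mx (F : fieldType) (m n : nat)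
    (x y : 'cV[F]_m) (z w : 'cV[F]_n) (a b : F) :
    'M[F]_((1 + m) + (1 + n)) :=
  block_mx (block_mx 0 x^T
                     y 0)        (block_mx a%:M 0
                                           0    0)
           (block_mx b%:M 0
                     0    0)     (block_mx 0 z^T
                                           w 0).

(* Main.v *)
Require Import Defs.
From HB Require Import structures.
From mathcomp Require Import all_boot all_order all_algebra ring.

Set Implicit Arguments.
Unset Strict Implicit.
Unset Printing Implicit Defensive.

Import GRing.Theory.
Local Open Scope ring_scope.

(** Write [u = M e1], where [e1] is the first basis vector.  Because
    [z^T w = 0], the matrix [M] sends [u] to a vector [v] and [v] back to
    [zeta *: u], and every column of [M ^+ 3] is a combination of [u] and [v].
    So the powers of [M] stabilize on the plane spanned by [u] and [v], on
    which [M] acts invertibly, by the matrix [N] that swaps the two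
    directions with weights 1 and [zeta].

    A core EP inverse [X] of any [A] is pinned down by [A *m X] being the
    self-adjoint projector onto the stable range of [A]: this gives uniqueness
    ([core_EP_unique]).  If the columns of [U] form a basis of that range and
    [A *m U = U *m N], such a projector exists exactly when the Gram matrix
    [G = U^* U] is invertible, and then it equals [U G^-1 U^*] and
    [X = U N^-1 G^-1 U^*] ([core_EP_gram_unit], [core_EP_gram]).  Over a
    general field with involution [G] may well be singular: this is the only
    obstruction.

    For the double star, [u] and [v] have disjoint supports, so their Gram
    matrix is diagonal.  Its entries are [u^* u = h] and [v^* v = beta], whence
    the two conditions; and [X] is [beta^-1 u v^* + (zeta h)^-1 v u^*], which is
    the displayed block matrix.

    The dual statement is the same one for [M^T], which is again a double star
    matrix, with [x, y] and [z, w] and [a, b] exchanged; this turns [h, beta]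
    into [q, alpha] and fixes [zeta]. *)

(** * Core EP inverses and Gram matrices *)


Section CoreEP.
Variables (F : fieldType) (conj : {rmorphism F -> F}).
Hypothesis conjK : involutive conj.

Lemma adjmxK (p q : nat) (A : 'M[F]_(p, q)) : adjmx conj (adjmx conj A) = A.
Proof. by apply/matrixP=> i j; rewrite !mxE conjK. Qed.

Lemma adjmxM (p q r : nat) (A : 'M[F]_(p, q)) (B : 'M[F]_(q, r)) :
  adjmx conj (A *m B) = adjmx conj B *m adjmx conj A.
Proof. by rewrite /adjmx map_mxM trmx_mul. Qed.

Lemma adjmx_inv (p : nat) (A : 'M[F]_p) :
  adjmx conj (invmx A) = invmx (adjmx conj A).
Proof. by rewrite /adjmx map_invmx trmx_inv. Qed.

Lemma adjmx_scalar c : adjmx conj (c%:M : 'M_1) = (conj c)%:M.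
Proof. by rewrite /adjmx map_scalar_mx tr_scalar_mx. Qed.

Lemma adjmx0 p q : adjmx conj (0 : 'M_(p, q)) = 0.
Proof. by rewrite /adjmx map_mx0 trmx0. Qed.

Lemma adjmxZ p q c (A : 'M_(p, q)) :
  adjmx conj (c *: A) = conj c *: adjmx conj A.
Proof. by rewrite /adjmx map_mxZ linearZ. Qed.

Lemma adjmx_col p q r (A : 'M_(p, r)) (B : 'M_(q, r)) :
  adjmx conj (col_mx A B) = row_mx (adjmx conj A) (adjmx conj B).
Proof. by rewrite /adjmx map_col_mx tr_col_mx. Qed.

Lemma adjmx_row p q r (A : 'M_(r, p)) (B : 'M_(r, q)) :
  adjmx conj (row_mx A B) = col_mx (adjmx conj A) (adjmx conj B).
Proof. by rewrite /adjmx map_row_mx tr_row_mx. Qed.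

(** Any larger exponent works as well, so that two inverses can be compared at
    a common one. *)
Lemma core_EP_exponentW (p : nat) (A X : 'M[F]_p) (k d : nat) :
  X *m A ^+ k.+1 = A ^+ k -> X *m A ^+ (k + d).+1 = A ^+ (k + d).
Proof. by move=> E; rewrite -addSn !exprD -!mulmxE mulmxA E. Qed.

Lemma core_EP_range (p : nat) (A X : 'M[F]_p) (j : nat) :
  A *m X ^+ 2 = X -> A ^+ j *m X ^+ j.+1 = X.
Proof.
move=> E; elim: j => [|j IHj]; first by rewrite expr0 mul1mx expr1.
rewrite exprSr -mulmxE -mulmxA -(addn2 j) addnC exprD -mulmxE.
by rewrite (mulmxA A) E mulmxE -exprS.
Qed.

(** The columns of [A *m X] lie in the range of every power of [A]; together
    with the next lemma, this makes [A *m X] a projector onto the stable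
    range. *)
Lemma core_EP_proj (p : nat) (A X : 'M[F]_p) (j : nat) :
  A *m X ^+ 2 = X -> A *m X = A ^+ j.+1 *m X ^+ j.+1.
Proof. by move=> E; rewrite exprS -mulmxE -mulmxA core_EP_range. Qed.

Lemma core_EP_proj_fix (p : nat) (A X : 'M[F]_p) (k : nat) :
  X *m A ^+ k.+1 = A ^+ k -> A *m X *m A ^+ k.+1 = A ^+ k.+1.
Proof. by move=> E; rewrite -mulmxA E mulmxE -exprS. Qed.

(** [A *m X] and [A *m Y] are self-adjoint projectors onto the same stable
    range, hence equal, and [X = X *m (A *m X)] is determined by the projector
    because [X] inverts [A] on that range. *)
Lemma core_EP_unique (p : nat) (A X Y : 'M[F]_p) :
  is_core_EP_inverse conj A X -> is_core_EP_inverse conj A Y -> X = Y.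
Proof.
move=> [[k kX] X2 PX] [[l lY] Y2 PY].
have {}kX := core_EP_exponentW l kX.
have {}lY := core_EP_exponentW k lY; rewrite addnC in lY.
move: (k + l)%N kX lY => {}k kX kY.
have XY : A *m X *m (A *m Y) = A *m Y.
  by rewrite {1}(core_EP_proj k Y2) mulmxA core_EP_proj_fix // -core_EP_proj.
have YX : A *m Y *m (A *m X) = A *m X.
  by rewrite {1}(core_EP_proj k X2) mulmxA core_EP_proj_fix // -core_EP_proj.
have eqP : A *m X = A *m Y.
  by rewrite -PX -YX adjmxM PX PY XY.
have XAX : X *m (A *m X) = X.
  by rewrite (core_EP_proj k X2) mulmxA kX core_EP_range.
by rewrite -XAX eqP (core_EP_proj k Y2) mulmxA kX core_EP_range.
Qed.

(** The columns of [U] span the range of [A ^+ k], and [N] is the invertible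
    matrix by which [A] acts on that range. *)
Section Factorization.
Variables (p r k : nat) (A : 'M[F]_p) (U : 'M[F]_(p, r)) (N : 'M[F]_r).
Variable C : 'M[F]_(r, p).
Hypothesis AU : A *m U = U *m N.
Hypothesis N_unit : N \in unitmx.
Hypothesis Ak : A ^+ k = U *m C.
Let G := adjmx conj U *m U.

(** On the range of [U] the candidate acts as the inverse of [A], since
    [X *m U = U *m N^-1]; and [A *m X] is the orthogonal projector
    [U G^-1 U^*]. *)
Lemma core_EP_gram : G \in unitmx ->
  is_core_EP_inverse conj A (U *m invmx N *m invmx G *m adjmx conj U).
Proof.
move=> G_unit; set X := _ *m adjmx conj U.
have XU : X *m U = U *m invmx N.
  by rewrite /X -[_ *m U]mulmxA -/G mulmxKV.
have AX : A *m X = U *m invmx G *m adjmx conj U.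
  by rewrite /X !mulmxA AU mulmxK.
have G_herm : adjmx conj G = G by rewrite /G adjmxM adjmxK.
split; first exists k.
- by rewrite exprS -mulmxE Ak !mulmxA -(mulmxA X) AU mulmxA XU mulmxKV.
- rewrite expr2 -mulmxE mulmxA AX {1}/X !mulmxA.
  by rewrite -(mulmxA _ (adjmx conj U)) -/G mulmxKV.
- by rewrite AX !adjmxM adjmxK adjmx_inv G_herm mulmxA.
Qed.

Lemma range_core_power (j : nat) : exists V, U = A ^+ j *m V.
Proof.
elim: j => [|j [V UV]]; first by exists U; rewrite expr0 mul1mx.
exists (V *m invmx N).
by rewrite exprS -mulmxE -mulmxA (mulmxA _ V) -UV mulmxA AU mulmxK.
Qed.

(** The projector [P = A *m X] fixes [U] and has the form [U *m D].  Being
    self-adjoint, it is also [D^* U^*], so that [D^* G = U] and [G] has at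
    least the rank of [U]. *)
Lemma core_EP_gram_unit : row_full U ->
  core_EP_invertible conj A -> G \in unitmx.
Proof.
move=> fullU [X [[l lX] X2 PX]].
have {}lX := core_EP_exponentW k lX; rewrite addnC in lX.
have [V UV] := range_core_power (k + l).+1.
have PU : A *m X *m U = U by rewrite UV mulmxA core_EP_proj_fix.
have [D PD] : exists D, A *m X = U *m D.
  exists (C *m A ^+ l.+1 *m X ^+ (k + l).+1).
  by rewrite (core_EP_proj (k + l) X2) -addnS exprD -mulmxE Ak !mulmxA.
have {PU} GU : adjmx conj D *m G = U by rewrite mulmxA -adjmxM -PD PX.
have leGU := mxrankM_maxr (adjmx conj D) G; rewrite GU (eqP fullU) in leGU.
by rewrite -row_full_unit /row_full eqn_leq rank_leq_col.
Qed.

End Factorization.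

(** Transposing suffices here, without conjugation: an adjoint would bring in
    [conj] on all the entries, whereas [M^T] is visibly a double star matrix. *)
Lemma is_dual_core_EP_tr (p : nat) (A X : 'M[F]_p) :
  is_dual_core_EP_inverse conj A X <-> is_core_EP_inverse conj A^T X^T.
Proof.
have trX (B : 'M[F]_p) j : (B ^+ j)^T = B^T ^+ j.
  elim: j => [|j IHj]; first by rewrite !expr0 trmx1.
  by rewrite exprS exprSr -!mulmxE trmx_mul IHj.
have adjT (B : 'M[F]_p) : adjmx conj B^T = (adjmx conj B)^T.
  by rewrite /adjmx !map_trmx.
split=> [[[k kX] X2 PX]|[[k kX] X2 PX]]; split.
- by exists k; rewrite -!trX -trmx_mul kX.
- by rewrite -trX -trmx_mul X2.
- by rewrite -trmx_mul adjT PX.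
- by exists k; apply: trmx_inj; rewrite trmx_mul !trX.
- by apply: trmx_inj; rewrite trmx_mul !trX.
- by apply: trmx_inj; rewrite -adjT trmx_mul.
Qed.

End CoreEP.

(** * The double star matrix *)

Lemma dotcvE (F : fieldType) (p : nat) (s t : 'cV[F]_p) : s^T *m t = (dotcv s t)%:M.
Proof. exact: mx11_scalar. Qed.

Lemma dotcvC (F : fieldType) (p : nat) (s t : 'cV[F]_p) : dotcv s t = dotcv t s.
Proof.
by rewrite /dotcv !mxE; apply: eq_bigr => i _; rewrite !mxE mulrC.
Qed.

Section DoubleStar.
Variables (F : fieldType) (conj : {rmorphism F -> F}).
Hypothesis conjK : involutive conj.
Variables (m n : nat) (x y : 'cV[F]_m) (z w : 'cV[F]_n) (a b : F).

Let M := double_star_mx x y z w a b.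
Let zeta := dotcv x y + a * b.
Let h := b * conj b + dotcv (map_mx conj y) y.
Let beta := zeta * conj zeta + b * conj b * dotcv (map_mx conj w) w.

Definition double_star_cEP : 'M[F]_((1 + m) + (1 + n)) :=
  block_mx
    (block_mx 0                              (h^-1 *: adjmx conj y)
              ((beta^-1 * conj zeta) *: y)   0)
    (block_mx (h^-1 * conj b)%:M             0
              0                              ((beta^-1 * conj b) *: (y *m adjmx conj w)))
    (block_mx (beta^-1 * conj zeta * b)%:M   0
              0                              ((b * h^-1 * zeta^-1) *: (w *m adjmx conj y)))
    (block_mx 0                              ((beta^-1 * b * conj b) *: adjmx conj w)
              ((b * conj b * h^-1 * zeta^-1) *: w)   0).

(* [u = M e1] and [v = M u] span the stable range. *)
Let u : 'cV[F]_((1 + m) + (1 + n)) := col_mx (col_mx 0 y) (col_mx b%:M 0).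
Let v : 'cV[F]_((1 + m) + (1 + n)) :=
  col_mx (col_mx zeta%:M 0) (col_mx 0 (b *: w)).
Let U := row_mx u v.
Let N : 'M[F]_(1 + 1) := block_mx 0 zeta%:M 1%:M 0.
(* The coordinates of the columns of [M ^+ 3] in the basis [u, v]. *)
Let C : 'M[F]_(1 + 1, (1 + m) + (1 + n)) :=
  col_mx (row_mx (row_mx zeta%:M 0) (row_mx 0 (a *: z^T)))
         (row_mx (row_mx 0 x^T) (row_mx a%:M 0)).

Hypotheses (b_neq0 : b != 0) (zw_eq0 : dotcv z w = 0) (zeta_neq0 : zeta != 0).

Let mxs0 := (mul0mx, mulmx0, addr0, add0r).

Lemma mul_double_star_u : M *m u = v.
Proof.
rewrite /M /double_star_mx /u !mul_block_col !mxs0 !add_col_mx !mxs0.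
by rewrite dotcvE -scalar_mxM -raddfD mul_mx_scalar.
Qed.

(** [M *m v] has a further component [b * z^T w] along [e3], the centre of the
    second star; it vanishes by [zw_eq0]. *)
Lemma mul_double_star_v : M *m v = zeta *: u.
Proof.
rewrite /M /double_star_mx /v !mul_block_col !mxs0 !add_col_mx !mxs0.
rewrite -scalemxAr dotcvE zw_eq0 !mul_mx_scalar raddf0 !scale_col_mx !scaler0.
by rewrite addr0.
Qed.

Lemma mul_double_star_basis : M *m U = U *m N.
Proof.
rewrite mul_mx_row mul_double_star_u mul_double_star_v mul_row_block.
by rewrite !mulmx0 mulmx1 mul_mx_scalar addr0 add0r.
Qed.

Lemma double_star_cube : M ^+ 3 = U *m C.
Proof.
rewrite exprS expr2 -!mulmxE {2 3}/M /double_star_mx !mulmx_block.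
rewrite !mxs0 !add_block_mx !mxs0 !dotcvE zw_eq0 raddf0 addr0.
rewrite mulmx_block !mulmx_block !mxs0 !add_block_mx !mxs0.
rewrite /U /C mul_row_col /u /v !mul_col_row !add_block_mx !mxs0.
rewrite -(mul_scalar_mx a z^T) -(mul_mx_scalar b w) !mulmxA !dotcvE zw_eq0.
rewrite raddf0 !mul0mx !addr0 -!scalar_mxM -!mulmxDl -!raddfD.
by rewrite -mulrDl /= -scalar_mxM.
Qed.

Lemma mulN_inv : N *m block_mx 0 1%:M (zeta^-1)%:M 0 = 1%:M.
Proof.
rewrite mulmx_block !mxs0 -scalar_mxM mulfV // mul1mx.
by rewrite -scalar_mx_block.
Qed.

Lemma N_unit : N \in unitmx.
Proof. by case/mulmx1_unit: mulN_inv. Qed.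

Lemma basis_full : row_full U.
Proof.
apply/row_fullP.
(* [b] and [zeta] are the entries of [u] and [v] at the centres [e3], [e1]. *)
exists (col_mx (row_mx 0 (row_mx (b^-1)%:M 0))
               (row_mx (row_mx (zeta^-1)%:M 0) 0)).
rewrite /U /u /v mul_col_row !mul_row_col !mxs0.
rewrite -!scalar_mxM !mulVf //.
by rewrite -scalar_mx_block.
Qed.

(** [u] lives on the leaves of the first star and the centre of the second, [v]
    on the complementary vertices: they are orthogonal for any involution. *)
Lemma gram_basis : adjmx conj U *m U = block_mx h%:M 0 0 beta%:M.
Proof.
rewrite adjmx_row mul_col_row !adjmx_col !adjmx0 !adjmx_scalar adjmxZ.
rewrite !mul_row_col !mxs0 -!scalar_mxM -scalemxAr -scalemxAl.
rewrite /adjmx !dotcvE !scale_scalar_mx -!raddfD /=.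
by rewrite addrC (mulrC _ b) (mulrC _ zeta) mulrA.
Qed.

Lemma double_star_cEP_factor : h != 0 -> beta != 0 ->
  U *m invmx N *m invmx (adjmx conj U *m U) *m adjmx conj U = double_star_cEP.
Proof.
move=> h_neq0 beta_neq0.
have invN : invmx N = block_mx 0 1%:M (zeta^-1)%:M 0.
  by apply: (can_inj (mulKmx N_unit)); rewrite mulmxV ?mulN_inv ?N_unit.
have invG : invmx (block_mx h%:M 0 0 beta%:M) =
  block_mx (h^-1)%:M 0 0 (beta^-1)%:M :> 'M_(1 + 1).
  have GK : block_mx h%:M 0 0 beta%:M *m
      block_mx (h^-1)%:M 0 0 (beta^-1)%:M = 1%:M :> 'M_(1 + 1).
    by rewrite mulmx_block !mxs0 -!scalar_mxM !mulfV // -scalar_mx_block.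
  have [Gu _] := mulmx1_unit GK.
  by apply: (can_inj (mulKmx Gu)); rewrite mulmxV ?GK.
rewrite gram_basis invG invN /U.
rewrite !mul_row_block !mxs0 !mulmx1 !mul_mx_scalar /u /v.
rewrite adjmx_row mul_row_col !adjmx_col !adjmx0 !adjmx_scalar adjmxZ.
rewrite -!scalemxAl !mul_col_row !mxs0 -!scalemxAl -!scalemxAr.
rewrite !scale_block_mx !add_block_mx !scaler0 !mxs0.
rewrite !mul_scalar_mx !mul_mx_scalar !scale_scalar_mx !scalerA.
congr (block_mx (block_mx _ _ _ _) (block_mx _ _ _ _)
                (block_mx _ _ _ _) (block_mx _ _ _ _)).
all: first [congr (_ *: _) | congr (_%:M)]; field.
all: by rewrite ?h_neq0 ?beta_neq0 ?zeta_neq0.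
Qed.

Lemma double_star_core_EP :
  (core_EP_invertible conj M <-> h != 0 /\ beta != 0) /\
  (core_EP_invertible conj M ->
   forall X, is_core_EP_inverse conj M X <-> X = double_star_cEP).
Proof.
have gramP : adjmx conj U *m U \in unitmx <-> h != 0 /\ beta != 0.
  rewrite gram_basis unitmxE det_ublock !det_scalar1 unitfE mulf_eq0 negb_or.
  by split=> /andP.
have cEP : h != 0 /\ beta != 0 -> is_core_EP_inverse conj M double_star_cEP.
  move=> hb; have [h_neq0 beta_neq0] := hb.
  rewrite -double_star_cEP_factor //.
  apply: (core_EP_gram conjK mul_double_star_basis N_unit double_star_cube).
  exact/gramP.
have invP : core_EP_invertible conj M -> h != 0 /\ beta != 0.
  move=> invM; apply/gramP.
  exact: (core_EP_gram_unit mul_double_star_basis N_unit double_star_cube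
            basis_full invM).
split; first by split=> [/invP // | /cEP cM]; exists double_star_cEP.
move=> /invP/cEP cM X; split=> [cX | -> //].
exact: (core_EP_unique cX cM).
Qed.

End DoubleStar.

Lemma double_star_tr (F : fieldType) (m n : nat) (x y : 'cV[F]_m)
    (z w : 'cV[F]_n) (a b : F) :
  (double_star_mx x y z w a b)^T = double_star_mx y x w z b a.
Proof.
by rewrite /double_star_mx !tr_block_mx !trmx0 !tr_scalar_mx !trmxK.
Qed.

Theorem theorem4p2 (F : fieldType) (conj : {rmorphism F -> F})
    (conjK : involutive conj) (m n : nat) (m_gt0 : (0 < m)%N) (n_gt0 : (0 < n)%N)
    (x y : 'cV[F]_m) (z w : 'cV[F]_n) (a b : F)
    (x_neq0 : forall i, x i 0 != 0) (y_neq0 : forall i, y i 0 != 0)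
    (z_neq0 : forall i, z i 0 != 0) (w_neq0 : forall i, w i 0 != 0)
    (a_neq0 : a != 0) (b_neq0 : b != 0)
    (xy_neq0 : dotcv x y != 0) (zw_eq0 : dotcv z w = 0)
    (zeta_neq0 : dotcv x y + a * b != 0) :
  let M := double_star_mx x y z w a b in
  let zeta := dotcv x y + a * b in
  let h := b * conj b + dotcv (map_mx conj y) y in
  let beta := zeta * conj zeta + b * conj b * dotcv (map_mx conj w) w in
  let q := a * conj a + dotcv (map_mx conj x) x in
  let alpha := zeta * conj zeta + a * conj a * dotcv (map_mx conj z) z in
  let McEP : 'M[F]_((1 + m) + (1 + n)) :=
    block_mx
      (block_mx 0                              (h^-1 *: adjmx conj y)
                ((beta^-1 * conj zeta) *: y)   0)
      (block_mx (h^-1 * conj b)%:M             0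
                0                              ((beta^-1 * conj b) *: (y *m adjmx conj w)))
      (block_mx (beta^-1 * conj zeta * b)%:M   0
                0                              ((b * h^-1 * zeta^-1) *: (w *m adjmx conj y)))
      (block_mx 0                              ((beta^-1 * b * conj b) *: adjmx conj w)
                ((b * conj b * h^-1 * zeta^-1) *: w)   0) in
  let MdcEP : 'M[F]_((1 + m) + (1 + n)) :=
    block_mx
      (block_mx 0                              ((conj zeta * alpha^-1) *: x^T)
                (q^-1 *: map_mx conj x)        0)
      (block_mx (conj zeta * alpha^-1 * a)%:M  0
                0                              (((q * zeta)^-1 * a) *: (map_mx conj x *m z^T)))
      (block_mx (conj a * q^-1)%:M             0
                0                              ((conj a * alpha^-1) *: (map_mx conj z *m x^T)))
      (block_mx 0                              (((q * zeta)^-1 * a * conj a) *: z^T)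
                ((a * conj a * alpha^-1) *: map_mx conj z)   0) in
  ((core_EP_invertible conj M <-> h != 0 /\ beta != 0) /\
   (core_EP_invertible conj M ->
    forall X, is_core_EP_inverse conj M X <-> X = McEP)) /\
  ((dual_core_EP_invertible conj M <-> q != 0 /\ alpha != 0) /\
   (dual_core_EP_invertible conj M ->
    forall X, is_dual_core_EP_inverse conj M X <-> X = MdcEP)).
Proof.
move=> M zeta h beta q alpha McEP MdcEP; split.
  exact: double_star_core_EP.
have trM : M^T = double_star_mx y x w z b a by exact: double_star_tr.
have zetaT : dotcv y x + b * a = zeta by rewrite dotcvC mulrC.
have := @double_star_core_EP F conj conjK m n y x w z b a a_neq0.
rewrite dotcvC zw_eq0 zetaT => /(_ erefl zeta_neq0).
rewrite -/q -/alpha -trM => -[invT uniqT].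
have dualP : dual_core_EP_invertible conj M <-> core_EP_invertible conj M^T.
  split=> [[X MX] | [X MX]]; exists X^T; apply/is_dual_core_EP_tr => //.
  by rewrite trmxK.
have MdcEP_tr : MdcEP^T = double_star_cEP conj y x z b a.
  rewrite /MdcEP /double_star_cEP !tr_block_mx.
  rewrite !trmx0 !tr_scalar_mx !linearZ /= !trmx_mul !trmxK.
  rewrite zetaT -/q -/alpha.
  congr (block_mx (block_mx _ _ _ _) (block_mx _ _ _ _)
                  (block_mx _ _ _ _) (block_mx _ _ _ _));
    by first [congr (_ *: _) | congr (_%:M)]; rewrite ?invfM; ring.
split; first by apply: (iff_trans dualP).
move=> /dualP/uniqT cX X; apply: (iff_trans (is_dual_core_EP_tr _ _ _)).
apply: (iff_trans (cX _)); rewrite -MdcEP_tr.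
by split=> [/trmx_inj | ->].
Qed.
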